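(* Let $G$ be a connected representation-finite biquiver with vertices $1,\dots,t$, and let $z=(z_1,\dots,z_t)$ be an integer vector with nonnegative components. There exists an indecomposable representation of $G$ of dimension $z$ if and only if $q_G(z)=1$. Moreover, such an indecomposable representation is determined by $z$ uniquely up to isomorphism.
   Context: A biquiver is a finite directed graph $G$ with vertices $1,\dots,t$, in which loops and multiple arrows are allowed and each arrow is either full ($u\longrightarrow v$) or dashed ($u\dashrightarrow v$). A map $\mathcal A:U\to V$ between complex vector spaces is semilinear if it is additive and $\mathcal A(\alpha u)=\bar\alpha\,\mathcal Au$. A representation $\mathcal A$ of $G$ consists of: - a finite-dimensional complex vector space $\mathcal A_v$ for each vertex $v$; - a linear map $\mathcal A_\alpha:\mathcal A_u\to\mathcal A_v$ for each full arrow $\alpha:u\to v$; - a semilinear map $\mathcal A_\alpha:\mathcal A_u\to\mathcal A_v$ for each dashed arrow $\alpha:u\dashrightarrow v$. Its dimension is $(\dim\mathcal A_1,\dots,\dim\mathcal A_t)$. A morphism $\mathcal F:\mathcal A\to\mathcal B$ is a family of linear maps $\mathcal F_v:\mathcal A_v\to\mathcal B_v$ with $\mathcal B_\alpha\mathcal F_u=\mathcal F_v\mathcal A_\alpha$ for every arrow $\alpha$ from $u$ to $v$. It is an isomorphism if all $\mathcal F_v$ are bijective. Direct sums are taken componentwise. A representation is indecomposable if its dimension is nonzero and it is not isomorphic to a direct sum of two representations of nonzero dimension. $G$ is representation-finite if it has only finitely many isomorphism classes of indecomposable representations. The Tits form is $q_G(x)=\sum_i x_i^2-\sum x_ux_v$,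 where the second sum runs over all arrows $u\to v$ or $u\dashrightarrow v$ of $G$. *)

(* Defs.v *)
From HB Require Import structures.
From mathcomp Require Import all_boot all_order all_algebra.
Set Implicit Arguments. Unset Strict Implicit. Unset Printing Implicit Defensive.
Import Order.TTheory GRing.Theory Num.Theory.
Local Open Scope ring_scope.

(* A biquiver: vertices 'I_t (vertex i+1 of the paper is i here), arrows
   given as a list of triples (source, target, dashed?). Loops and
   multiple arrows are allowed. *)
Record biquiver := Biquiver {
  bq_t : nat;
  bq_arr : seq ('I_bq_t * 'I_bq_t * bool) }.

Definition arrow (G : biquiver) := 'I_(size (bq_arr G)).
Definition arr_of (G : biquiver) (a : arrow G) := tnth (in_tuple (bq_arr G)) a.
Definition asrc (G : biquiver) (a : arrow G) : 'I_(bq_t G) := (arr_of a).1.1.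
Definition atgt (G : biquiver) (a : arrow G) : 'I_(bq_t G) := (arr_of a).1.2.
Definition adashed (G : biquiver) (a : arrow G) : bool := (arr_of a).2.

Definition bq_adj (G : biquiver) : rel 'I_(bq_t G) := fun u v =>
  has (fun e : 'I_(bq_t G) * 'I_(bq_t G) * bool =>
         ((e.1.1 == u) && (e.1.2 == v)) || ((e.1.1 == v) && (e.1.2 == u)))
      (bq_arr G).
Definition bq_connected (G : biquiver) : Prop :=
  forall u v : 'I_(bq_t G), connect (@bq_adj G) u v.

Definition twist (C : numClosedFieldType) (d : bool) (c : C) : C :=
  if d then c^* else c.

Unset Implicit Arguments.
Record rep (C : numClosedFieldType) (G : biquiver) := Rep {
  rsp : 'I_(bq_t G) -> vectType C;
  rmap : forall a : arrow G, rsp (asrc a) -> rsp (atgt a);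
  rmap_add : forall a x y, rmap a (x + y) = rmap a x + rmap a y;
  rmap_scale : forall a (c : C) x,
      rmap a (c *: x) = twist (adashed a) c *: rmap a x }.
Set Implicit Arguments.
Arguments rsp {C G}.
Arguments rmap {C G}.
Arguments rmap_add {C G}.
Arguments rmap_scale {C G}.

Definition rdim C G (A : rep C G) (v : 'I_(bq_t G)) : nat :=
  \dim (fullv : {vspace rsp A v}).

Definition is_morphism C G (A B : rep C G)
    (F : forall v, rsp A v -> rsp B v) : Prop :=
  (forall v x y, F v (x + y) = F v x + F v y) /\
  (forall v (c : C) x, F v (c *: x) = c *: F v x) /\
  (forall (a : arrow G) x, rmap B a (F (asrc a) x) = F (atgt a) (rmap A a x)).

Definition rep_iso C G (A B : rep C G) : Prop :=
  exists F : forall v, rsp A v -> rsp B v,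
    is_morphism F /\ forall v, bijective (F v).

Section DSum.
Variables (C : numClosedFieldType) (G : biquiver) (A B : rep C G).
Definition dsum_sp (v : 'I_(bq_t G)) : vectType C := (rsp A v * rsp B v)%type.
Definition dsum_map (a : arrow G) (x : dsum_sp (asrc a)) : dsum_sp (atgt a) :=
  (rmap A a x.1, rmap B a x.2).
Arguments dsum_map : clear implicits.
Lemma dsum_add a x y : dsum_map a (x + y) = dsum_map a x + dsum_map a y.
Proof. by rewrite /dsum_map /= !rmap_add. Qed.
Lemma dsum_scale a (c : C) x :
  dsum_map a (c *: x) = twist (adashed a) c *: dsum_map a x.
Proof. by rewrite /dsum_map /= !rmap_scale. Qed.
Definition dsum : rep C G := @Rep C G dsum_sp dsum_map dsum_add dsum_scale.
End DSum.

Definition nonzero_rep C G (A : rep C G) : Prop := exists v, rdim A v <> 0%N.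

Definition indecomposable C G (A : rep C G) : Prop :=
  nonzero_rep A /\
  ~ (exists B1 B2 : rep C G,
        nonzero_rep B1 /\ nonzero_rep B2 /\ rep_iso A (dsum B1 B2)).

Definition rep_finite (C : numClosedFieldType) (G : biquiver) : Prop :=
  exists (n : nat) (f : 'I_n -> rep C G),
    forall A : rep C G, indecomposable A -> exists i, rep_iso A (f i).

Definition tits (G : biquiver) (z : 'I_(bq_t G) -> nat) : int :=
  \sum_(i < bq_t G) (z i)%:Z ^+ 2
  - \sum_(e <- bq_arr G) (z e.1.1)%:Z * (z e.1.2)%:Z.
Arguments tits : clear implicits.
Arguments rep_finite : clear implicits.
Arguments bq_connected : clear implicits.

(* Main.v *)
Require Import Defs.
From HB Require Import structures.
From mathcomp Require Import all_boot all_order all_algebra.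
From mathcomp Require Import zify ring.
From Stdlib Require Import Classical.
Set Implicit Arguments. Unset Strict Implicit. Unset Printing Implicit Defensive.
Import Order.TTheory GRing.Theory Num.Theory VectorInternalTheory.
Local Open Scope ring_scope.

(* Untwisting.  If an arrow lies on a cycle, one-dimensional representations
   with varying modulus on it are pairwise non-isomorphic.  So every arrow is a
   bridge, the set of dashed arrows is a coboundary s(u) + s(v), and conjugating
   the spaces with s(v) = 1 turns representations of G into matrix
   representations of the underlying quiver.  For these,
     q(m, n) = dim Hom(M, N) - dim Ext(M, N).

   Rigid representations.  Let M of dimension z have dim Ext(M, M) minimal.  If
   it is nonzero, choose psi representing a nonzero class: along the line
   M + x psi the class of psi stays nonzero for almost all x, which makes the
   representations on the line pairwise non-isomorphic up to finitely many
   exceptions.  So finiteness gives a rigid representation in every dimension,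
   and q(z) = dim End >= 1 for z <> 0.

   Bricks.  By Ringel's argument, an indecomposable M that is not a brick has an
   endomorphism of square zero and minimal rank; its image embeds in an
   indecomposable summand K of its kernel with Ext(K, K) <> 0, which contradicts
   induction and q >= 1.  Hence indecomposables are rigid bricks with q = 1, and
   a rigid M with q = 1 is a brick.

   Uniqueness.  Let M and K be rigid bricks of dimension z, with q(z) = 1.  Then
   Hom(M, K) <> 0; let I be the image of a nonzero map, of dimension i.  Since
   Ext(I, K) = 0, q(i, z) = dim Hom(I, K) >= 1, so there is a nonzero I -> M.
   The composite M -> I -> M is a nonzero scalar, hence M -> K is injective. *)

(** * Minimal elements and ranks along a line of matrices *)

Lemma ex_minimal (T : Type) (P : T -> Prop) (f : T -> nat) :
  (exists x, P x) -> exists x, P x /\ forall y, P y -> (f x <= f y)%N.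
Proof.
case=> x0 Px0.
suff H n x : P x -> (f x <= n)%N ->
    exists x, P x /\ forall y, P y -> (f x <= f y)%N by exact: (H _ x0).
elim: n x => [|n IH] x Px xn.
  by exists x; split=> // y _; move: xn; rewrite leqn0 => /eqP->.
case: (classic (exists y, P y /\ (f y < f x)%N)) => [[y [Py yx]]|nex].
  by apply: (IH y) => //; rewrite -ltnS (leq_trans yx).
exists x; split=> // y Py; rewrite leqNgt; apply/negP => yx.
by apply: nex; exists y.
Qed.

(** In characteristic zero the naturals below [size p] are distinct, and they outnumber the roots of
    [p]. *)
Lemma nonroot (F : numDomainType) (p : {poly F}) :
  p != 0 -> exists x, p.[x] != 0.
Proof.
move=> p0; pose s : seq F := [seq i%:R | i <- iota 0 (size p)].
have us : uniq s.
  by rewrite map_inj_uniq ?iota_uniq // => i j /eqP; rewrite eqr_nat => /eqP.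
case: (boolP (all (root p) s)) => [ar|/allPn[x _ nx]]; last by exists x.
by have := max_poly_roots p0 ar us; rewrite size_map size_iota ltnn.
Qed.

Section GenericRank.
Variable F : fieldType.

(** Lower semicontinuity of the rank. One-sided inverses of the two factors of a full-rank
    factorization of [A] compress [A + x *: B] to a square matrix of size [\rank A]; its determinant
    is a polynomial in [x] with value 1 at 0. *)
Lemma rank_generic m n (A B : 'M[F]_(m, n)) :
  exists2 p : {poly F}, p != 0 &
    forall x, p.[x] != 0 -> (\rank A <= \rank (A + x *: B)%R)%N.
Proof.
pose P := pinvmx (col_base A); pose Q := pinvmx (row_base A).
have PAQ : P *m A *m Q = 1%:M.
  rewrite -[X in P *m X *m Q]mulmx_base mulmxA mulVpmx ?col_base_full // mul1mx.
  by rewrite mulmxVp ?row_base_free.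
pose p := \det (1%:M + 'X *: map_mx polyC (P *m B *m Q)).
have pE x : p.[x] = \det (P *m (A + x *: B) *m Q).
  rewrite -[p.[x]]/(horner_eval x p) -det_map_mx; congr (\det _).
  rewrite mulmxDr mulmxDl PAQ -scalemxAr -scalemxAl; apply/matrixP => i j.
  by rewrite !mxE rmorphD rmorphM rmorph_nat /= /horner_eval hornerX hornerC.
exists p; last first.
  move=> x; rewrite pE -unitfE -unitmxE => /mxrank_unit <-.
  exact: leq_trans (mxrankM_maxl _ _) (mxrankM_maxr _ _).
have: p.[0] != 0 by rewrite pE scale0r addr0 PAQ det1 oner_eq0.
by apply: contra_neq => ->; rewrite horner0.
Qed.

(** Since [u] kills [A], for [x != 0] the row [u *m B] lies in the row space of [A + x *: B].
    Stacking this constant row under [A] raises the rank by one, and the raised rank persists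
    generically. *)
Lemma rank_generic_gt m n (A B : 'M[F]_(m, n)) (u : 'rV_m) :
  u *m A = 0 -> ~~ (u *m B <= A)%MS ->
  exists2 p : {poly F}, p != 0 &
    forall x, p.[x] != 0 -> (\rank A < \rank (A + x *: B)%R)%N.
Proof.
move=> uA uB.
have [p p0 pP] := rank_generic (col_mx A (u *m B)) (col_mx B 0).
exists ('X * p) => [|x]; first by rewrite mulf_neq0 ?polyX_eq0.
rewrite !hornerE mulf_eq0 negb_or => /andP[x0 /pP].
rewrite scale_col_mx add_col_mx scaler0 addr0 -!addsmxE => le1.
have sub : (u *m B <= (A + x *: B)%R)%MS.
  rewrite -(eqmx_scale (u *m B) x0).
  suff -> : x *: (u *m B) = u *m (A + x *: B) by exact: submxMl.
  by rewrite mulmxDr uA add0r scalemxAr.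
apply: leq_trans (leq_trans le1 _); last first.
  by apply: mxrankS; rewrite addsmx_sub submx_refl.
by apply: rank_ltmx; rewrite ltmxE addsmxSl addsmx_sub submx_refl.
Qed.
End GenericRank.

(** * Matrix representations of a quiver *)

Section MatrixRep.
Variables (F : numClosedFieldType) (t k : nat) (src tgt : 'I_k -> 'I_t).
Implicit Types d m n : 'I_t -> nat.

(** Vectors are rows and matrices act on the right: composites read from left to right, [row_free]
    means injective and [row_full] surjective. *)
Definition mrep d := forall a, 'M[F]_(d (src a), d (tgt a)).

Definition is_hom m n (M : mrep m) (N : mrep n)
    (X : forall v, 'M[F]_(m v, n v)) : Prop :=
  forall a, M a *m X (tgt a) = X (src a) *m N a.

(** A family [Y] is the off-diagonal block of an extension of M by N, and the extension splits
    exactly when [Y] has the displayed form; hence this says Ext(M, N) = 0. *)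
Definition ext0 m n (M : mrep m) (N : mrep n) : Prop :=
  forall Y : (forall a, 'M[F]_(m (src a), n (tgt a))),
    exists X : forall v, 'M[F]_(m v, n v),
      forall a, Y a = X (src a) *m N a - M a *m X (tgt a).

Definition brick m (M : mrep m) : Prop :=
  forall X, is_hom M M X -> exists c, forall v, X v = c%:M.

Definition indec m (M : mrep m) : Prop :=
  (exists v, m v != 0%N) /\
  forall e, is_hom M M e -> (forall v, e v *m e v = e v) ->
    (forall v, e v = 0) \/ (forall v, e v = 1%:M).

Definition euler m n : int :=
  \sum_v (m v * n v)%N%:Z - \sum_a (m (src a) * n (tgt a))%N%:Z.

Lemma is_hom_comp l m n (L : mrep l) (M : mrep m) (N : mrep n) X Y :
  is_hom L M X -> is_hom M N Y -> is_hom L N (fun v => X v *m Y v).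
Proof. by move=> hX hY a; rewrite mulmxA hX -mulmxA hY mulmxA. Qed.

Lemma is_hom1 m (M : mrep m) : is_hom M M (fun v => 1%:M).
Proof. by move=> a; rewrite mulmx1 mul1mx. Qed.

Lemma is_homB m n (M : mrep m) (N : mrep n) X Y :
  is_hom M N X -> is_hom M N Y -> is_hom M N (fun v => X v - Y v).
Proof. by move=> hX hY a; rewrite mulmxBr hX hY mulmxBl. Qed.

Lemma is_hom_scalar m (M : mrep m) c : is_hom M M (fun v => c%:M).
Proof. by move=> a; rewrite mul_scalar_mx mul_mx_scalar. Qed.

Lemma is_hom_inv m n (M : mrep m) (N : mrep n) X Y :
  is_hom M N X -> (forall v, X v *m Y v = 1%:M) ->
  (forall v, Y v *m X v = 1%:M) -> is_hom N M Y.
Proof.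
move=> hX XY YX a.
rewrite -[LHS]mul1mx -(YX (src a)) -mulmxA; congr (_ *m _).
by rewrite mulmxA -hX -mulmxA XY mulmx1.
Qed.

Lemma subrep_exists r m (M : mrep m) (U : forall v, 'M[F]_(r v, m v)) :
  (forall a, (U (src a) *m M a <= U (tgt a))%MS) ->
  exists d (S : mrep d) (j : forall v, 'M[F]_(d v, m v)),
    [/\ is_hom S M j, forall v, row_free (j v), forall v, (j v :=: U v)%MS
      & forall v, d v = \rank (U v)].
Proof.
move=> sU; pose j v := row_base (U v).
exists (fun v => \rank (U v)).
exists (fun a => j (src a) *m M a *m pinvmx (j (tgt a))), j.
split=> [a|v|v|//]; [|exact: row_base_free|exact: eq_row_base].
by rewrite mulmxKpV // (eqmxMr _ (eq_row_base _)) eq_row_base.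
Qed.

Lemma is_hom_lift l m n (L : mrep l) (M : mrep m) (N : mrep n) i X :
  is_hom M N i -> (forall v, row_free (i v)) -> is_hom L N X ->
  (forall v, (X v <= i v)%MS) ->
  exists2 Y, is_hom L M Y & forall v, X v = Y v *m i v.
Proof.
move=> hi fi hX sX; exists (fun v => X v *m pinvmx (i v)) => [a|v].
  apply: (row_free_inj (fi (tgt a))).
  rewrite /= -[LHS]mulmxA mulmxKpV // hX.
  by rewrite -[RHS]mulmxA hi mulmxA mulmxKpV.
by rewrite mulmxKpV.
Qed.

Lemma image_fact m n (M : mrep m) (N : mrep n) X : is_hom M N X ->
  exists d (I : mrep d) p j,
    [/\ is_hom M I p, is_hom I N j, forall v, row_full (p v),
        forall v, row_free (j v) & forall v, X v = p v *m j v].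
Proof.
move=> hX.
have [a|d [I [j [hj fj eqj dX]]]] := @subrep_exists _ _ N X.
  by rewrite -hX submxMl.
have [v|p hp Xpj] := is_hom_lift hj fj hX; first by rewrite eqj.
exists d, I, p, j; split=> // v; rewrite -col_leq_rank [X in (X <= _)%N]dX Xpj.
exact: mxrankM_maxl.
Qed.

Lemma kernel_rep m n (M : mrep m) (N : mrep n) X : is_hom M N X ->
  exists d (K : mrep d) i,
    [/\ is_hom K M i, forall v, row_free (i v),
        forall v, (i v :=: kermx (X v))%MS
      & forall v, d v = \rank (kermx (X v))].
Proof.
move=> hX; apply: subrep_exists => a; apply/sub_kermxP.
by rewrite -mulmxA hX mulmxA mulmx_ker mul0mx.
Qed.

(** Families [Y] obey no compatibility condition, so vertexwise retractions of [i] extend them from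
    L to M. This is the surjectivity of Ext(M, N) -> Ext(L, N) for a hereditary algebra. *)
Lemma ext0_sub l m n (L : mrep l) (M : mrep m) (N : mrep n) i :
  is_hom L M i -> (forall v, row_free (i v)) -> ext0 M N -> ext0 L N.
Proof.
move=> hi fi eM Y.
have [X XP] := eM (fun a => pinvmx (i (src a)) *m Y a).
exists (fun v => i v *m X v) => a.
rewrite -[Y a]mul1mx -(mulmxVp (fi (src a))) -[LHS]mulmxA (XP a) mulmxBr.
by rewrite !mulmxA hi.
Qed.

(* The obstruction to extending f along K -> M -> I is a class in Ext(I, N). *)
Lemma hom_extend l m r n (K : mrep l) (M : mrep m) (I : mrep r) (N : mrep n)
    i p f :
  is_hom K M i -> (forall v, row_free (i v)) ->
  is_hom M I p -> (forall v, row_full (p v)) ->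
  (forall v, (i v :=: kermx (p v))%MS) ->
  ext0 I N -> is_hom K N f ->
  exists2 h, is_hom M N h & forall v, i v *m h v = f v.
Proof.
move=> hi fi hp fp ip eI hf.
have [h ih] : exists h : forall v, 'M_(m v, n v), forall v, i v *m h v = f v.
  by exists (fun v => pinvmx (i v) *m f v) => v; rewrite mulmxA mulmxVp ?mul1mx.
have ip0 v : i v *m p v = 0 by apply/sub_kermxP; rewrite -ip.
(* [Y] measures how far the vertexwise extension [h] is from a morphism. It vanishes on K, so it
   factors through [p]; splitting the resulting family on I gives the correction to [h]. *)
pose Y a := h (src a) *m N a - M a *m h (tgt a).
have iY a : i (src a) *m Y a = 0.
  by rewrite /Y mulmxBr !mulmxA ih -hi -mulmxA ih hf subrr.
have pY a : p (src a) *m (pinvmx (p (src a)) *m Y a) = Y a.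
  apply/eqP; rewrite -subr_eq0 mulmxA -{2}[Y a]mul1mx -mulmxBl.
  have /submxP[D ->] :
      (p (src a) *m pinvmx (p (src a)) - 1%:M <= i (src a))%MS.
    rewrite ip; apply/sub_kermxP.
    by rewrite mulmxBl -mulmxA mulVpmx // mulmx1 mul1mx subrr.
  by rewrite -mulmxA iY mulmx0.
have [X XP] := eI (fun a => pinvmx (p (src a)) *m Y a).
exists (fun v => h v - p v *m X v) => [a|v]; last first.
  by rewrite mulmxBr ih mulmxA ip0 mul0mx subr0.
have := pY a; rewrite XP /Y mulmxBr !mulmxA -hp mulmxBr mulmxBl !mulmxA.
set x := p _ *m _ *m _; set y := M a *m p _ *m _; set z := M a *m _.
set w := h _ *m _ => e.
have -> : z = w - (x - y) by rewrite e opprB addrC subrK.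
by rewrite opprB addrA [LHS]addrAC addrK.
Qed.

End MatrixRep.

(** * Families of matrices as row vectors *)

Section Families.
Variables (F : fieldType) (p : nat) (r c : 'I_p -> nat).

Definition fvec (X : forall i, 'M[F]_(r i, c i)) :
  'rV[F]_(\sum_i r i * c i) := \mxrow_i mxvec (X i).
Definition fmx (u : 'rV[F]_(\sum_i r i * c i)) i : 'M[F]_(r i, c i) :=
  vec_mx (submxrow u i).

Lemma fvecK X i : fmx (fvec X) i = X i.
Proof. by rewrite /fmx mxrowK mxvecK. Qed.

Lemma fmxK u : fvec (fmx u) = u.
Proof.
by rewrite -[RHS]submxrowK; apply: eq_mxrow => i; rewrite /fmx vec_mxK.
Qed.

Lemma eq_fvec X Y : (forall i, X i = Y i) -> fvec X = fvec Y.
Proof. by move=> XY; apply: eq_mxrow => i; rewrite XY. Qed.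

Lemma fvec0 X : fvec X = 0 <-> forall i, X i = 0.
Proof.
have e i : fmx 0 i = 0 by apply/matrixP => x y; rewrite !mxE.
split=> [X0 i|X0]; first by rewrite -[LHS]fvecK X0.
by rewrite -[RHS]fmxK; apply: eq_fvec => i; rewrite e.
Qed.

Lemma fmx_linear a u w i : fmx (a *: u + w) i = a *: fmx u i + fmx w i.
Proof. by rewrite /fmx -linearP; congr vec_mx; apply/matrixP => x y; rewrite !mxE. Qed.

Lemma fvec_linear a X Y :
  fvec (fun i => a *: X i + Y i) = a *: fvec X + fvec Y.
Proof.
by rewrite -[RHS]fmxK; apply: eq_fvec => i; rewrite fmx_linear !fvecK.
Qed.
End Families.

(** * The linear map with kernel Hom and cokernel Ext *)

Section HomMatrix.
Variables (F : numClosedFieldType) (t k : nat) (src tgt : 'I_k -> 'I_t).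
Implicit Types d m n : 'I_t -> nat.
Local Notation mrep := (@mrep F t k src tgt).

Definition hom_fun m n (M : mrep m) (N : mrep n)
    (u : 'rV[F]_(\sum_v m v * n v)) :
    'rV[F]_(\sum_a m (src a) * n (tgt a)) :=
  fvec (fun a => fmx u (src a) *m N a - M a *m fmx u (tgt a)).

Lemma hom_fun_linear m n (M : mrep m) (N : mrep n) : linear (hom_fun M N).
Proof.
move=> c u w; rewrite /hom_fun -fvec_linear; apply: eq_fvec => a.
rewrite !fmx_linear mulmxDl mulmxDr -scalemxAl -scalemxAr scalerBr opprD.
by rewrite addrACA.
Qed.

HB.instance Definition _ m n (M : mrep m) (N : mrep n) :=
  GRing.isLinear.Build F _ _ _ (hom_fun M N) (hom_fun_linear M N).

Definition hom_mx m n (M : mrep m) (N : mrep n) := lin1_mx (hom_fun M N).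
Definition hdim m n (M : mrep m) (N : mrep n) : nat :=
  \rank (kermx (hom_mx M N)).

Lemma hom_mxE m n (M : mrep m) (N : mrep n) X :
  fvec X *m hom_mx M N =
  fvec (fun a => X (src a) *m N a - M a *m X (tgt a)).
Proof.
by rewrite mul_rV_lin1 /=; apply: eq_fvec => a; rewrite !fvecK.
Qed.

Lemma hom_mx_ker m n (M : mrep m) (N : mrep n) X :
  (fvec X <= kermx (hom_mx M N))%MS <-> is_hom M N X.
Proof.
split=> [/sub_kermxP|hX].
  by rewrite hom_mxE => /fvec0 X0 a; apply/esym/eqP; rewrite -subr_eq0 X0.
apply/sub_kermxP; rewrite hom_mxE; apply/fvec0 => a.
by rewrite hX subrr.
Qed.

Lemma ext0P m n (M : mrep m) (N : mrep n) :
  ext0 M N <-> row_full (hom_mx M N).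
Proof.
split=> [eM|fD Y].
  rewrite -sub1mx; apply/rV_subP => w _.
  have [X XP] := eM (fmx w).
  apply/submxP; exists (fvec X); rewrite hom_mxE -[LHS]fmxK.
  exact: eq_fvec.
have /submxP[u] : (fvec Y <= hom_mx M N)%MS by apply: submx_full.
rewrite -[u]fmxK hom_mxE => e; exists (fmx u) => a.
by rewrite -[LHS]fvecK e fvecK.
Qed.

(** Rank-nullity: the two sums in [euler] are the dimensions of the source and target of [hom_mx],
    and the cokernel rank is dim Ext. *)
Lemma euler_dim m n (M : mrep m) (N : mrep n) :
  (hdim M N)%:Z =
  euler src tgt m n + (\rank (cokermx (hom_mx M N)))%:Z.
Proof.
rewrite /hdim /euler mxrank_ker mxrank_coker -!subzn ?rank_leq_row ?rank_leq_col //.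
by rewrite !(big_morph Posz PoszD (erefl _)); ring.
Qed.

Lemma euler_le_hdim m n (M : mrep m) (N : mrep n) :
  euler src tgt m n <= (hdim M N)%:Z.
Proof. by rewrite (euler_dim M N) lerDl. Qed.

Lemma ext0_hdim m n (M : mrep m) (N : mrep n) :
  ext0 M N <-> (hdim M N)%:Z = euler src tgt m n.
Proof.
rewrite ext0P euler_dim -cokermx_eq0 -mxrank_eq0; split=> [/eqP->|].
  by rewrite addr0.
by move/eqP; rewrite -subr_eq0 addrC addKr.
Qed.

Lemma hdim_gt0 m n (M : mrep m) (N : mrep n) :
  (0 < hdim M N)%N <->
  exists2 X, is_hom M N X & exists v, X v != 0.
Proof.
rewrite lt0n mxrank_eq0; split.
  case/rowV0Pn => u; rewrite -[u]fmxK => /hom_mx_ker hu u0.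
  exists (fmx u) => //; apply: NNPP => nX; case/negP: u0; apply/eqP/fvec0 => v.
  by apply/eqP/negPn/negP => Xv; apply: nX; exists v.
case=> X /hom_mx_ker hX [v Xv]; apply/rowV0Pn; exists (fvec X) => //.
by apply: contra Xv => /eqP/fvec0 ->.
Qed.

Lemma hdim_mono m n n' (M : mrep m) (N : mrep n) (N' : mrep n') g :
  is_hom N N' g -> (forall v, row_free (g v)) -> (hdim M N <= hdim M N')%N.
Proof.
move=> hg fg.
pose f (u : 'rV[F]_(\sum_v m v * n v)) : 'rV[F]_(\sum_v m v * n' v) :=
  fvec (fun v => fmx u v *m g v).
have lf : linear f.
  move=> c u w; rewrite /f -fvec_linear; apply: eq_fvec => v.
  by rewrite fmx_linear mulmxDl scalemxAl.
pose f' : {linear _ -> _} := HB.pack f (GRing.isLinear.Build F _ _ _ f lf).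
pose G := lin1_mx f'.
have GE u : u *m G = f u by rewrite mul_rV_lin1.
have fG : row_free G.
  apply: inj_row_free => u; rewrite GE => /fvec0 u0.
  rewrite -[u]fmxK; apply/fvec0 => v; apply/eqP.
  by rewrite -(mulmx_free_eq0 _ (fg v)) u0.
rewrite /hdim -(mxrankMfree _ fG); apply/mxrankS/rV_subP => w.
case/submxP => D ->; rewrite mulmxA GE; apply/hom_mx_ker.
apply: is_hom_comp hg; apply/hom_mx_ker; rewrite fmxK; exact: submxMl.
Qed.

(** As M is nonzero, the scalars form a line in End(M); dimension one means that they exhaust it. *)
Lemma brick_hdim m (M : mrep m) : (exists v, m v != 0%N) ->
  brick M <-> hdim M M = 1%N.
Proof.
case=> v0 mv0; have mv0' : (0 < m v0)%N by rewrite lt0n.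
pose id1 := fvec (fun v => 1%:M : 'M[F]_(m v)).
have id_n0 : id1 != 0.
  apply/eqP => /fvec0/(_ v0)/matrixP/(_ (Ordinal mv0') (Ordinal mv0')).
  by rewrite !mxE eqxx => /eqP; rewrite oner_eq0.
have idk : (id1 <= kermx (hom_mx M M))%MS by apply/hom_mx_ker/is_hom1.
have rid : \rank id1 = 1%N by rewrite rank_rV id_n0.
split=> [bM|h1].
  apply/eqP; rewrite eqn_leq -{2}rid mxrankS // andbT -rid.
  apply: mxrankS; apply/rV_subP => u; rewrite -[u]fmxK => /hom_mx_ker/bM[c uc].
  apply/sub_rVP; exists c; rewrite -[RHS]addr0.
  have -> : 0 = fvec (fun v => 0 : 'M[F]_(m v)) by apply/esym/fvec0.
  rewrite -fvec_linear; apply: eq_fvec => v.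
  by rewrite addr0 uc scalemx1.
move=> X /hom_mx_ker.
have [_ /esym ek] := mxrank_leqif_sup idk.
move: ek; rewrite rid -/(hdim _ _) h1 eqxx => ek /submx_trans/(_ ek).
case/sub_rVP => c Xc; exists c => v.
by rewrite -[LHS]fvecK Xc -[_ *: _]addr0 fmx_linear fvecK scalemx1 -[RHS]addr0
  ; congr (_ + _); apply/matrixP => i j; rewrite !mxE.
Qed.

(** A line of representations yields a line of matrices, to which the generic rank lemmas apply. *)
Lemma hom_mx_perturb m n (M P : mrep m) (N Q : mrep n) x :
  hom_mx (fun a => M a + x *: P a) (fun a => N a + x *: Q a) =
  hom_mx M N + x *: hom_mx P Q.
Proof.
apply/row_matrixP => i; rewrite !rowE mulmxDr -scalemxAr.
rewrite -[delta_mx _ _]fmxK !hom_mxE addrC -fvec_linear; apply: eq_fvec => a.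
rewrite mulmxDr mulmxDl -scalemxAr -scalemxAl scalerBr opprD.
by rewrite addrACA addrC.
Qed.
End HomMatrix.

(** * Existence of rigid representations *)

Section Rigid.
Variables (F : numClosedFieldType) (t k : nat) (src tgt : 'I_k -> 'I_t).
Implicit Types d m n : 'I_t -> nat.
Local Notation mrep := (@mrep F t k src tgt).

Definition miso d (M N : mrep d) : Prop :=
  exists2 X, is_hom M N X & forall v, X v \in unitmx.

(** Predicates replace representatives so that a class can be described by isomorphism to an object
    of another category, here a representation of the biquiver. *)
Definition finitely_many_classes d : Prop :=
  exists (I : finType) (P : I -> mrep d -> Prop),
    (forall M, exists i, P i M) /\
    (forall i M N, P i M -> P i N -> miso M N).

(** The identity lies in the kernel of [hom_mx M M], and the perturbation sends it to [psi], outside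
    the image. So generically dim Hom(M, M + x psi) < dim End(M), which an isomorphism forbids. *)
Lemma line_not_iso d (M psi : mrep d) :
  ~~ (fvec psi <= hom_mx M M)%MS ->
  exists2 p : {poly F}, p != 0 &
    forall x, p.[x] != 0 -> ~ miso M (fun a => M a + x *: psi a).
Proof.
move=> npsi.
have [||p p0 pP] := @rank_generic_gt _ _ _ (hom_mx M M)
  (hom_mx (fun a => 0) psi) (fvec (fun v => 1%:M)).
- by apply/sub_kermxP/hom_mx_ker/is_hom1.
- apply: contra npsi; rewrite hom_mxE.
  suff -> : fvec (fun a => 1%:M *m psi a - 0 *m 1%:M) = fvec psi by [].
  by apply: eq_fvec => a; rewrite mul1mx mul0mx subr0.
exists p => // x /pP lt_rk [X hX uX].
have := hdim_mono M hX (fun v => etrans (row_free_unit _) (uX v)).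
move: lt_rk; rewrite -hom_mx_perturb /hdim !mxrank_ker.
have -> : hom_mx (fun a => M a + x *: 0) (fun a => M a + x *: psi a) =
          hom_mx M (fun a => M a + x *: psi a).
  apply/row_matrixP => i; rewrite !rowE -[delta_mx _ _]fmxK !hom_mxE.
  by apply: eq_fvec => a; rewrite scaler0 addr0.
by have := rank_leq_row (hom_mx M (fun a => M a + x *: psi a)); lia.
Qed.

Lemma rigid_exists d : finitely_many_classes d -> exists M : mrep d, ext0 M M.
Proof.
case=> I [P [Pex Piso]].
(* The minimized quantity is the corank of [hom_mx M M], that is dim Ext(M, M). *)
have [M [_ Mmax]] := @ex_minimal (mrep d) (fun=> True)
  (fun M => (\sum_a d (src a) * d (tgt a) - \rank (hom_mx M M))%N)
  (ex_intro _ (fun a => 0) Logic.I).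
exists M; apply/ext0P; apply: contraT; rewrite -sub1mx => /row_subPn[i0 npsi].
move: npsi; rewrite -[row _ _]fmxK; pose psi : mrep d := fmx (row i0 1%:M); rewrite -/psi => npsi.
pose phi x : mrep d := fun a => M a + x *: psi a.
(* For almost all x, psi is still transversal to the orbit of phi x. *)
have [g g0 gP] : exists2 g : {poly F}, g != 0 &
    forall x, g.[x] != 0 -> ~~ (fvec psi <= hom_mx (phi x) (phi x))%MS.
  have [g g0 gP] := rank_generic (col_mx (hom_mx M M) (fvec psi))
                                 (col_mx (hom_mx psi psi) 0).
  exists g => // x /gP.
  rewrite scale_col_mx add_col_mx scaler0 addr0 -hom_mx_perturb => le1.
  apply/negP => sub.
  (* Were [psi] in the image at [phi x], the rank there would exceed the rank at M, against the
     minimality of dim Ext. *)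
  have lt1 : (\rank (hom_mx M M) < \rank (col_mx (hom_mx M M) (fvec psi)))%N.
    rewrite -addsmxE; apply: rank_ltmx.
    by rewrite ltmxE addsmxSl addsmx_sub submx_refl.
  have le2 : (\rank (col_mx (hom_mx (phi x) (phi x)) (fvec psi)) <=
              \rank (hom_mx (phi x) (phi x)))%N.
    by rewrite -addsmxE; apply: mxrankS; rewrite addsmx_sub submx_refl.
  have := Mmax (phi x) Logic.I.
  have := rank_leq_col (hom_mx (phi x) (phi x)).
  by have := leq_trans lt1 (leq_trans le1 le2); lia.
(* If class [i] is met at a good point [y], then [phi x] is [phi y] moved by [x - y] along [psi], so
   other good parameters of the class are roots of the polynomial of [line_not_iso] recentred at
   [y]. A class never met gets the constant 1. *)
have [q q0 qP] : exists2 q : I -> {poly F}, forall i, q i != 0 &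
    forall i x, g.[x] != 0 -> P i (phi x) -> (q i).[x] = 0.
  suff /fin_all_exists[q qP] : forall i, exists q : {poly F}, q != 0 /\
      forall x, g.[x] != 0 -> P i (phi x) -> q.[x] = 0.
    by exists q => i; case: (qP i).
  move=> i.
  case: (classic (exists x, g.[x] != 0 /\ P i (phi x))) => [[y [gy Py]]|nex].
    have [p p0 pP] := line_not_iso (gP _ gy).
    exists (p \Po ('X - y%:P)); split=> [|x gx Px].
      by rewrite comp_poly2_eq0 // size_XsubC.
    apply/eqP/negPn/negP; rewrite horner_comp !hornerE => /pP; apply.
    have [X hX uX] := Piso _ _ _ Py Px; exists X => // a.
    by rewrite hX /phi -addrA -scalerDl [y + (x - y)]addrC subrK.
  by exists 1; rewrite oner_neq0; split=> // x gx Px; case: nex; exists x.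
have [|x] := @nonroot F (g * \prod_i q i).
  by rewrite mulf_neq0 //; apply/prodf_neq0 => i _.
rewrite hornerM horner_prod mulf_eq0 negb_or => /andP[gx /prodf_neq0 qx].
by have [i Pi] := Pex (phi x); have := qx i isT; rewrite (qP i x gx Pi) eqxx.
Qed.
End Rigid.

(** * Indecomposables are bricks *)

Lemma leq_sum_eq (I : finType) (f g : I -> nat) :
  (forall i, f i <= g i)%N -> (\sum_i g i <= \sum_i f i)%N ->
  forall i, f i = g i.
Proof.
move=> le_fg le_s i; apply/eqP; rewrite eqn_leq le_fg /=.
rewrite leqNgt; apply/negP => lt_i; move: le_s; apply/negP; rewrite -ltnNge.
rewrite (bigD1 i) //= [X in (_ < X)%N](bigD1 i) //= -addSn leq_add //.
exact: leq_sum.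
Qed.

Section Bricks.
Variables (F : numClosedFieldType) (t k : nat) (src tgt : 'I_k -> 'I_t).
Implicit Types d m n : 'I_t -> nat.
Local Notation mrep := (@mrep F t k src tgt).
Hypothesis pos : forall z : 'I_t -> nat,
  (exists v, z v != 0%N) -> 1 <= euler src tgt z z.

(** The chain 1 <= q(m) <= dim End(M) = 1 collapses, and the difference of the last two terms is dim
    Ext(M, M). *)
Lemma brick_euler m (M : mrep m) : (exists v, m v != 0%N) -> brick M ->
  euler src tgt m m = 1 /\ ext0 M M.
Proof.
move=> m0 /(brick_hdim M m0) h1.
have := euler_le_hdim M M; rewrite h1 => le1.
have e1 : euler src tgt m m = 1 by apply/le_anti; rewrite le1 pos.
by split=> //; apply/ext0_hdim; rewrite h1 e1.
Qed.

(** Schur's lemma: for an eigenvalue [c] of [X] at one vertex, [X - c] is not injective there, hence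
    zero everywhere. *)
Lemma division_brick m (M : mrep m) : (exists v, m v != 0%N) ->
  (forall X, is_hom M M X -> (exists v, X v != 0) ->
     forall v, row_free (X v)) ->
  brick M.
Proof.
case=> v0 mv0 inv X hX.
have mv0' : (0 < m v0)%N by rewrite lt0n.
have [c /eigenvalueP[u uX u0]] := eigenvalue_closed (X v0) mv0'.
exists c => v; apply/eqP; rewrite -subr_eq0; apply/negPn/negP => nXc.
have /(_ v0) := inv _ (is_homB hX (is_hom_scalar M c)) (ex_intro _ v nXc).
move=> /row_free_inj/(_ u 0).
rewrite mulmxBr uX mul_mx_scalar subrr mul0mx => /(_ erefl) u00.
by rewrite u00 eqxx in u0.
Qed.

(** Fitting's argument: equal ranks make [j *m p] invertible on the image, so
    [p *m invmx (j *m p) *m j] is an idempotent with the rank of [X]. *)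
Lemma square_rank_indec m (M : mrep m) X : indec M -> is_hom M M X ->
  (forall v, \rank (X v *m X v) = \rank (X v)) ->
  (forall v, X v = 0) \/ (forall v, row_free (X v)).
Proof.
move=> [_ iM] hX rX.
have [d [I [p [j [hp hj fp fj Xpj]]]]] := image_fact hX.
have dX v : \rank (X v) = d v.
  by rewrite Xpj mxrankMfree ?fj //; apply/eqP; exact: fp.
have ujp v : j v *m p v \in unitmx.
  rewrite -row_free_unit -row_leq_rank -[X in (X <= _)%N]dX -rX Xpj.
  rewrite -mulmxA [j v *m (_ *m _)]mulmxA.
  exact: leq_trans (mxrankM_maxr _ _) (mxrankM_maxl _ _).
have hjp := is_hom_comp hj hp.
have hjpV : is_hom I I (fun v => invmx (j v *m p v)).
  by apply: is_hom_inv hjp _ _ => v; rewrite ?mulmxV ?mulVmx.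
have [v|e0|e1] := iM _ (is_hom_comp (is_hom_comp hp hjpV) hj).
- rewrite /= !mulmxA -(mulmxA _ (j v)) -[_ *m _ *m (j v *m p v)]mulmxA mulVmx //.
  by rewrite mulmx1.
- left=> v; have := e0 v => /(congr1 (fun A => j v *m A *m p v)).
  rewrite !mulmxA mulmxV // mul1mx mulmx0 mul0mx => jp0.
  apply/eqP; rewrite -mxrank_eq0 -rX Xpj mulmxA -(mulmxA (p v)) jp0.
  by rewrite mulmx0 mul0mx mxrank0.
right=> v; rewrite -row_leq_rank -[X in (X <= _)%N](@mxrank1 F) -(e1 v) dX.
exact: leq_trans (mxrankM_maxr _ _) (rank_leq_row _).
Qed.

(* K' is a summand of K of minimal dimension such that the projection of u to
   it is nonzero. *)
Lemma indec_summand r l (I : mrep r) (K : mrep l) u :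
  is_hom I K u -> (exists v, u v != 0) ->
  exists d (K' : mrep d) p j,
    [/\ is_hom K K' p, is_hom K' K j, forall v, j v *m p v = 1%:M,
        exists v, u v *m p v != 0 & indec K'].
Proof.
move=> hu u0.
pose P e := [/\ is_hom K K e, forall v, e v *m e v = e v
               & exists v, u v *m e v != 0].
have [|e [[he ee ue] emin]] :=
  @ex_minimal _ P (fun e => (\sum_v \rank (e v))%N).
  exists (fun v => 1%:M); split; first exact: is_hom1.
    by move=> v; rewrite mulmx1.
  by case: u0 => v; exists v; rewrite mulmx1.
have [d [K' [p [j [hp hj fp fj epj]]]]] := image_fact he.
have jp v : j v *m p v = 1%:M.
  apply: (row_full_inj (fp v)); apply: (row_free_inj (fj v)).
  by rewrite /= mulmx1 mulmxA -epj -mulmxA -epj ee.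
have up : exists v, u v *m p v != 0.
  case: ue => v; rewrite epj mulmxA => ue; exists v.
  by apply: contraNneq ue => ->; rewrite mul0mx.
exists d, K', p, j; split=> //; split.
  case: up => v uv; exists v; apply: contraNneq uv => d0.
  by rewrite -mxrank_eq0 -leqn0 -[X in (_ <= X)%N]d0 rank_leq_col.
have de v : \rank (e v) = d v.
  by rewrite epj mxrankMfree ?fj //; apply/eqP; exact: fp.
(* Then [p f j] competes with [e] in the minimization and its rank is at most that of [f]; so [f]
   has full rank, and a full-rank idempotent is the identity. *)
have key f : is_hom K' K' f -> (forall v, f v *m f v = f v) ->
    (exists v, u v *m p v *m f v != 0) -> forall v, f v = 1%:M.
  move=> hf ff uf v.
  have Pf : P (fun v => p v *m f v *m j v).
    split.
    - exact: is_hom_comp (is_hom_comp hp hf) hj.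
    - move=> w; rewrite !mulmxA -(mulmxA _ (j w)) jp mulmx1.
      by rewrite -[p w *m _ *m f w]mulmxA ff.
    case: uf => w uf; exists w; apply: contraNneq uf.
    rewrite !mulmxA => /(congr1 (fun A => A *m p w)).
    by rewrite -(mulmxA _ (j w)) jp mulmx1 mul0mx => ->.
  have rf w : (\rank (p w *m f w *m j w) <= \rank (f w))%N.
    exact: leq_trans (mxrankM_maxl _ _) (mxrankM_maxr _ _).
  have le_f : (\sum_w d w <= \sum_w \rank (f w))%N.
    rewrite -(eq_bigr _ (fun w _ => de w)).
    exact: leq_trans (emin _ Pf) (leq_sum _ (fun w _ => rf w)).
  have /eqP ffree := leq_sum_eq (fun w => rank_leq_row (f w)) le_f v.
  by apply: (row_free_inj ffree); rewrite /= ff mul1mx.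
move=> f hf ff.
case: (classic (exists v, u v *m p v *m f v != 0)) => [uf|nuf].
  by right; apply: key.
left=> v; have uf w : u w *m p w *m f w = 0.
  by apply/eqP/negPn/negP => ufw; apply: nuf; exists w.
(* Here [f] kills the projection of [u], so [1 - f] does not, and [key] gives [1 - f = 1]. *)
have := key (fun v => 1%:M - f v) (is_homB (is_hom1 _) hf) _ _ v.
move=> H; apply/eqP; rewrite -oppr_eq0 -[- f v](addKr 1%:M) addrC.
rewrite H ?subrr // => [w|].
  by rewrite mulmxBr mulmx1 mulmxBl mul1mx ff subrr subr0.
case: up => w upw; exists w; by rewrite mulmxBr mulmx1 uf subr0.
Qed.

Theorem indec_brick m (M : mrep m) : indec M -> brick M.
Proof.
move: {2}(\sum_v m v)%N (leqnn (\sum_v m v)) => N.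
elim: N m M => [|N IH] m M leN iM.
  have [[v mv] _] := iM; case/negP: mv; rewrite -leqn0.
  by apply: leq_trans leN; rewrite (bigD1 v) //= leq_addr.
have [m0 idM] := iM.
pose P X := is_hom M M X /\ exists v, X v != 0.
have [|X [[hX X0] Xmin]] :=
  @ex_minimal _ P (fun X => (\sum_v \rank (X v))%N).
  exists (fun v => 1%:M); split; first exact: is_hom1.
  case: m0 => v mv; exists v; apply: contraNneq mv => m1.
  by rewrite -(@mxrank1 F (m v)) m1 mxrank0.
(* If the minimal rank is full, every nonzero endomorphism is injective and Schur applies. Otherwise
   a nontrivial idempotent of M is constructed. *)
case: (leqP (\sum_v m v) (\sum_v \rank (X v))) => [le_mX|lt_Xm].
  apply: division_brick => // Y hY Y0 v; apply/eqP; move: v.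
  apply: leq_sum_eq => [v|]; first exact: rank_leq_row.
  exact: leq_trans le_mX (Xmin Y (conj hY Y0)).
exfalso.
(* If nonzero, the square would have the same rank as [X] at each vertex by minimality, making [X]
   zero or injective. *)
have XX0 v : X v *m X v = 0.
  apply/eqP/negPn/negP => XXv.
  have PXX : P (fun v => X v *m X v).
    by split; [exact: (is_hom_comp hX hX) | exists v].
  have rXX := leq_sum_eq (fun v => mxrankM_maxl (X v) (X v)) (Xmin _ PXX).
  case: (square_rank_indec iM hX rXX) => [X00|fX].
    by case: X0 => w; rewrite X00 eqxx.
  by move: lt_Xm; rewrite (eq_bigr _ (fun v _ => eqP (fX v))) ltnn.
have [r [I [p [j [hp hj fp fj Xpj]]]]] := image_fact hX.
have rX v : \rank (X v) = r v.
  by rewrite Xpj mxrankMfree ?fj //; apply/eqP; exact: fp.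
have [l [K [i [hi fi ik lk]]]] := kernel_rep hX.
have jk v : (j v <= i v)%MS.
  rewrite ik; apply/sub_kermxP; apply: (row_full_inj (fp v)).
  by rewrite /= mulmxA -Xpj XX0 mulmx0.
have [u hu jui] := is_hom_lift hi fi hj jk.
have j0 : exists v, j v != 0.
  by case: X0 => v; rewrite Xpj => Xv; exists v; apply: contraNneq Xv => ->; rewrite mulmx0.
have u0 : exists v, u v != 0.
  by case: j0 => v; rewrite jui => jv; exists v; apply: contraNneq jv => ->; rewrite mul0mx.
have [d [K' [q [s [hq hs sq uq iK']]]]] := indec_summand hu u0.
(* I embeds in K': the composite M -> I -> K' -> K -> M is a nonzero endomorphism, so by minimality
   its rank is at least that of [X], which is dim I. *)
have fuq v : row_free (u v *m q v).
  apply/eqP; move: v; apply: leq_sum_eq => [v|]; first exact: rank_leq_row.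
  have PY : P (fun v => p v *m (u v *m q v) *m (s v *m i v)).
    split.
      exact (is_hom_comp (is_hom_comp hp (is_hom_comp hu hq))
                         (is_hom_comp hs hi)).
    case: uq => v uqv; exists v; apply: contraNneq uqv => e0.
    apply/eqP; apply: (row_full_inj (fp v)); rewrite mulmx0.
    have /row_free_inj : row_free (s v *m i v).
      rewrite /row_free mxrankMfree ?fi //.
      by apply/row_freeP; exists (q v); rewrite sq.
    by apply; rewrite /= e0 mul0mx.
  have := Xmin _ PY; rewrite (eq_bigr _ (fun v _ => rX v)) => leq1.
  apply: leq_trans leq1 _; apply: leq_sum => v _.
  exact: leq_trans (mxrankM_maxl _ _) (mxrankM_maxr _ _).
have dl v : (d v <= l v)%N.
  have fs : row_free (s v) by apply/row_freeP; exists (q v); rewrite sq.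
  by rewrite -(eqP fs) rank_leq_col.
have lt_lm : (\sum_v l v < \sum_v m v)%N.
  case: X0 => v Xv; rewrite (bigD1 v) //= [X in (_ < X)%N](bigD1 v) //=.
  rewrite -addSn leq_add // ?leq_sum // => [|w _]; rewrite lk mxrank_ker ?leq_subr //.
  by have := rank_leq_row (X v); move: Xv; rewrite -mxrank_eq0; lia.
have lt_dm : (\sum_v d v < \sum_v m v)%N.
  by apply: leq_ltn_trans lt_lm; apply: leq_sum.
have bK' : brick K'.
  by apply: IH iK'; rewrite -ltnS; apply: leq_trans lt_dm leN.
have [d0 _] := iK'.
have [_ eK'] := brick_euler d0 bK'.
have ip v : (i v :=: kermx (p v))%MS.
  apply/eqmxP; rewrite !ik; apply/andP; split; apply/sub_kermxP.
    by apply: (row_free_inj (fj v)); rewrite /= -mulmxA -Xpj mulmx_ker mul0mx.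
  by rewrite Xpj mulmxA mulmx_ker mul0mx.
(* By induction Ext(K', K') = 0, hence Ext(I, K') = 0, and the projection K -> K' extends to M. This
   makes K' a direct summand of M, nonzero and of smaller dimension. *)
have [h hh ihq] := hom_extend hi fi hp fp ip
  (ext0_sub (is_hom_comp hu hq) fuq eK') hq.
have sih v : s v *m i v *m h v = 1%:M by rewrite -mulmxA ihq sq.
have [v|e0|e1] := idM _ (is_hom_comp hh (is_hom_comp hs hi)).
- by rewrite -[LHS]mulmxA (mulmxA (s v *m i v)) sih mul1mx.
- case: d0 => v; apply/negP; rewrite negbK -(@mxrank1 F (d v)) mxrank_eq0.
  apply/eqP; transitivity ((s v *m i v *m h v) *m (s v *m i v *m h v)).
    by rewrite sih mulmx1.
  by rewrite -mulmxA (mulmxA (h v)) e0 mul0mx mulmx0.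
move: lt_dm; rewrite ltnNge => /negP; apply; apply: leq_sum => v _.
rewrite -[X in (X <= _)%N](@mxrank1 F) -(e1 v).
exact: leq_trans (mxrankM_maxl _ _) (rank_leq_col _).
Qed.
End Bricks.

(** * Comparing a brick with a rigid representation *)

Section Uniqueness.
Variables (F : numClosedFieldType) (t k : nat) (src tgt : 'I_k -> 'I_t).
Implicit Types d m n : 'I_t -> nat.
Local Notation mrep := (@mrep F t k src tgt).

Lemma brick_rigid_iso m n (M : mrep m) (K : mrep n) :
  m =1 n -> 1 <= euler src tgt m n -> brick M -> ext0 K K ->
  exists2 X, is_hom M K X & forall v, row_free (X v).
Proof.
move=> mn e1 bM eK.
have /hdim_gt0[X hX X0] : (0 < hdim M K)%N.
  by have := euler_le_hdim M K; lia.
exists X => //.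
have [d [I [p [j [hp hj fp fj Xpj]]]]] := image_fact hX.
have eI := ext0_sub hj fj eK.
have hIK : (0 < hdim I K)%N.
  apply/hdim_gt0; exists j => //; case: X0 => v; rewrite Xpj => Xv; exists v.
  by apply: contraNneq Xv => ->; rewrite mulmx0.
have /hdim_gt0[Y hY [v0 Y0]] : (0 < hdim I M)%N.
  (* The Euler form sees only dimension vectors, so its value dim Hom(I, K) on (I, K) also bounds
     dim Hom(I, M) from below. *)
  have := euler_le_hdim I M.
  have -> : euler src tgt d m = euler src tgt d n.
    congr (_ - _); first by apply: eq_bigr => v _; rewrite mn.
    by apply: eq_bigr => a _; rewrite mn.
  by move/ext0_hdim: eI => <-; lia.
(* The endomorphism M -> I -> M is a scalar, nonzero because [p] is surjective and [Y] is not zero;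
   so [p] is injective. *)
have [c cE] := bM _ (is_hom_comp hp hY).
have c0 : c != 0.
  apply: contraNneq Y0 => c0; apply/eqP; apply: (row_full_inj (fp v0)).
  by rewrite mulmx0 cE c0 raddf0.
move=> v; rewrite /row_free Xpj mxrankMfree ?fj // -/(row_free _).
apply/row_freeP; exists (c^-1 *: Y v).
by rewrite -scalemxAr cE scale_scalar_mx mulVf.
Qed.
End Uniqueness.

(** * Representations of the biquiver *)

Section RepIso.
Variables (C : numClosedFieldType) (G : biquiver).
Implicit Types A B : rep C G.

Lemma is_morphism_comp A B D (F : forall v, rsp A v -> rsp B v)
    (H : forall v, rsp B v -> rsp D v) :
  is_morphism F -> is_morphism H -> is_morphism (fun v x => H v (F v x)).
Proof.
case=> [FD [FZ Fa]] [HD [HZ Ha]].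
split=> [v x y|]; first by rewrite FD HD.
split=> [v c x|a x]; first by rewrite FZ HZ.
by rewrite Ha Fa.
Qed.

Lemma is_morphism0 A B (F : forall v, rsp A v -> rsp B v) v :
  is_morphism F -> F v 0 = 0.
Proof. by case=> _ [FZ _]; have := FZ v 0 0; rewrite !scale0r. Qed.

Lemma rep_isoP A B : rep_iso A B ->
  exists (F : forall v, rsp A v -> rsp B v) (H : forall v, rsp B v -> rsp A v),
    [/\ is_morphism F, is_morphism H,
        forall v, cancel (F v) (H v) & forall v, cancel (H v) (F v)].
Proof.
case=> F [mF bF].
have /fin_all_exists[H HP] : forall v, exists h, cancel (F v) h /\ cancel h (F v).
  by move=> v; case: (bF v) => h; exists h.
have FK v : cancel (F v) (H v) by case: (HP v).
have HK v : cancel (H v) (F v) by case: (HP v).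
exists F, H; split=> //; case: mF => FD [FZ Fa].
split=> [v x y|]; first by apply: (can_inj (FK v)); rewrite FD !HK.
split=> [v c x|a x]; first by apply: (can_inj (FK v)); rewrite FZ !HK.
by apply: (can_inj (FK _)); rewrite -Fa !HK.
Qed.

Lemma rep_iso_sym A B : rep_iso A B -> rep_iso B A.
Proof.
by case/rep_isoP => F [H [mF mH FK HK]]; exists H; split=> // v; exists (F v).
Qed.

Lemma rep_iso_trans A B D : rep_iso A B -> rep_iso B D -> rep_iso A D.
Proof.
case=> F [mF bF] [H [mH bH]]; exists (fun v x => H v (F v x)).
by split=> [|v]; [exact: is_morphism_comp mF mH | exact: bij_comp].
Qed.

Lemma rep_iso_dsum A B A' B' :
  rep_iso A A' -> rep_iso B B' -> rep_iso (dsum A B) (dsum A' B').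
Proof.
case/rep_isoP => F [F' [[FD [FZ Fa]] _ FK FK']].
case/rep_isoP => H [H' [[HD [HZ Ha]] _ HK HK']].
exists (fun v x => (F v x.1, H v x.2)); split; last first.
  by move=> v; exists (fun x => (F' v x.1, H' v x.2)) => [[x y]|[x y]] /=;
    rewrite ?FK ?HK ?FK' ?HK'.
split=> [v x y|]; first by rewrite /= FD HD.
split=> [v c x|a x]; first by rewrite /= FZ HZ.
by rewrite /= /dsum_map /= Fa Ha.
Qed.

Lemma rdim_iso A B : rep_iso A B -> forall v, rdim A v = rdim B v.
Proof.
suff le A' B' : rep_iso A' B' -> forall v, (rdim A' v <= rdim B' v)%N.
  by move=> AB v; apply/eqP; rewrite eqn_leq !le //; apply: rep_iso_sym.
case/rep_isoP => F [H [[FD [FZ _]] _ FK _]] v.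
have lF : linear (F v) by move=> c x y; rewrite FD FZ.
pose f : {linear _ -> _} :=
  HB.pack (F v) (GRing.isLinear.Build C _ _ _ (F v) lF).
have kf : lker (linfun f) == 0%VS.
  apply/lker0P => x y; rewrite !lfunE /=; exact: (can_inj (FK v)).
rewrite /rdim -(@limg_dim_eq _ _ _ (linfun f) fullv) ?dimvS ?subvf //.
by rewrite (eqP kf) capv0.
Qed.

Lemma rdim_dsum A B v : rdim (dsum A B) v = (rdim A v + rdim B v)%N.
Proof. by rewrite /rdim !dimvf. Qed.

(** Finiteness passes from indecomposables to all representations of bounded total dimension: a
    decomposable one splits into two nonzero summands, both within the previous bound. *)
Lemma rep_finite_cover : rep_finite C G -> forall N : nat,
  exists (I : finType) (f : I -> rep C G), forall A, nonzero_rep A ->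
    (\sum_v rdim A v <= N)%N -> exists i, rep_iso A (f i).
Proof.
case=> n [f fP]; elim=> [|N [I [g gP]]].
  exists void, (fun x : void => match x with end) => A [v Av].
  by rewrite leqn0 sum_nat_eq0 => /forallP/(_ v)/eqP.
exists ('I_n + I * I)%type.
exists (fun x => match x with
                 | inl i => f i | inr p => dsum (g p.1) (g p.2) end) => A A0 leA.
case: (classic (indecomposable A)) => [/fP[i iA]|nA]; first by exists (inl i).
have [B1 [B2 [B10 [B20 isoA]]]] : exists B1 B2 : rep C G,
    nonzero_rep B1 /\ nonzero_rep B2 /\ rep_iso A (dsum B1 B2).
  by apply: NNPP => nB; apply: nA.
have pos B : nonzero_rep B -> (0 < \sum_v rdim B v)%N.
  by case=> v /eqP Bv; rewrite (bigD1 v) //= ltn_addr // lt0n.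
have dimA : (\sum_v rdim A v = \sum_v rdim B1 v + \sum_v rdim B2 v)%N.
  by rewrite -big_split; apply: eq_bigr => v _; rewrite (rdim_iso isoA) rdim_dsum.
have p1 := pos _ B10; have p2 := pos _ B20.
have [|i1 iso1] := gP _ B10; first by lia.
have [|i2 iso2] := gP _ B20; first by lia.
exists (inr (i1, i2)); apply: rep_iso_trans isoA _.
exact: rep_iso_dsum.
Qed.
End RepIso.

(** * Conjugation, and untwisting along a potential on the vertices *)

Section Twisting.
Variable C : numClosedFieldType.

Lemma twistD b (x y : C) : twist b (x + y) = twist b x + twist b y.
Proof. by case: b; rewrite /= ?rmorphD. Qed.
Lemma twistM b (x y : C) : twist b (x * y) = twist b x * twist b y.
Proof. by case: b; rewrite /= ?rmorphM. Qed.
Lemma twist_twist b b' (x : C) : twist b (twist b' x) = twist (b (+) b') x.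
Proof. by case: b; case: b'; rewrite /= ?conjCK. Qed.
Lemma norm_twist b (x : C) : `|twist b x| = `|x|.
Proof. by case: b; rewrite /= ?norm_conjC. Qed.

Definition tw b m n (X : 'M[C]_(m, n)) := map_mx (twist b) X.

Lemma twK b m n : involutive (@tw b m n).
Proof. by move=> X; apply/matrixP => i j; rewrite !mxE twist_twist addbb. Qed.
Lemma twD b m n (X Y : 'M[C]_(m, n)) : tw b (X + Y) = tw b X + tw b Y.
Proof. by apply/matrixP => i j; rewrite !mxE twistD. Qed.
Lemma twZ b m n c (X : 'M[C]_(m, n)) : tw b (c *: X) = twist b c *: tw b X.
Proof. by apply/matrixP => i j; rewrite !mxE twistM. Qed.
Lemma tw0 b m n : tw b 0 = 0 :> 'M[C]_(m, n).
Proof. by apply/matrixP => i j; rewrite !mxE; case: b; rewrite /= ?rmorph0. Qed.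

Lemma linear_mx m n (f : 'rV[C]_m -> 'rV[C]_n) :
  linear f -> exists X, forall u, f u = u *m X.
Proof.
move=> lf; pose f' : {linear _ -> _} := HB.pack f (GRing.isLinear.Build C _ _ _ f lf).
by exists (lin1_mx f') => u; rewrite mul_rV_lin1.
Qed.
End Twisting.

Section Untwist.
Variables (C : numClosedFieldType) (G : biquiver) (s : 'I_(bq_t G) -> bool).
Hypothesis sP : forall a : arrow G, adashed a = s (asrc a) (+) s (atgt a).
Implicit Types d m n : 'I_(bq_t G) -> nat.
Local Notation mrep := (@mrep C _ _ (@asrc G) (@atgt G)).

Section ToRep.
Variables (d : 'I_(bq_t G) -> nat) (M : mrep d).
(** The space at [v] is read through conjugation when [s v] holds. The map is then semilinear
    exactly when [s] differs at the two ends, which by [sP] means that the arrow is dashed. *)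
Definition torep_map (a : arrow G) (x : 'rV[C]_(d (asrc a))) :
  'rV[C]_(d (atgt a)) := tw (s (atgt a)) (tw (s (asrc a)) x *m M a).
Arguments torep_map : clear implicits.
Lemma torep_add a x y : torep_map a (x + y) = torep_map a x + torep_map a y.
Proof. by rewrite /torep_map twD mulmxDl twD. Qed.
Lemma torep_scale a c x :
  torep_map a (c *: x) = twist (adashed a) c *: torep_map a x.
Proof. by rewrite /torep_map twZ -scalemxAl twZ twist_twist sP addbC. Qed.
Definition torep : rep C G := @Rep C G (fun v => 'rV[C]_(d v)) torep_map
  torep_add torep_scale.
End ToRep.

Lemma rdim_torep d (M : mrep d) v : rdim (torep M) v = d v.
Proof. by rewrite /rdim dimvf; exact: mul1n. Qed.

Lemma hom_morphism m n (M : mrep m) (N : mrep n) X : is_hom M N X ->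
  @is_morphism C G (torep M) (torep N) (fun v x => tw (s v) (tw (s v) x *m X v)).
Proof.
move=> hX; split=> [v x y|]; first by rewrite twD mulmxDl twD.
split=> [v c x|a x].
  by rewrite twZ -scalemxAl twZ twist_twist addbb.
by rewrite /= /torep_map !twK -!mulmxA hX.
Qed.

Lemma morphism_hom m n (M : mrep m) (N : mrep n)
    (f : forall v, 'rV[C]_(m v) -> 'rV[C]_(n v)) :
  @is_morphism C G (torep M) (torep N) f ->
  exists2 X, is_hom M N X & forall v x, f v x = tw (s v) (tw (s v) x *m X v).
Proof.
case=> fD [fZ fa].
have /fin_all_exists[X XP] : forall v, exists X, forall u : 'rV_(m v),
    tw (s v) (f v (tw (s v) u)) = u *m X.
  move=> v; apply: linear_mx => c x y.
  by rewrite twD twZ fD fZ twD twZ twist_twist addbb.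
exists X => [a|v x]; last by rewrite -XP !twK.
apply/row_matrixP => i; rewrite !rowE !mulmxA -!XP.
have := fa a (tw (s (asrc a)) (delta_mx 0 i)).
by rewrite /= /torep_map twK => <-; rewrite twK.
Qed.

Lemma torep_iso m n (M : mrep m) (N : mrep n) X : is_hom M N X ->
  (forall v, row_free (X v)) -> (forall v, row_full (X v)) ->
  rep_iso (torep M) (torep N).
Proof.
move=> hX fX gX.
exists (fun v x => tw (s v) (tw (s v) x *m X v)); split; first exact: hom_morphism.
move=> v; exists (fun x => tw (s v) (tw (s v) x *m pinvmx (X v))) => x.
  by rewrite twK -mulmxA mulmxVp // mulmx1 twK.
by rewrite twK -mulmxA mulVpmx // mulmx1 twK.
Qed.

Lemma iso_miso d (M N : mrep d) :
  rep_iso (torep M) (torep N) -> miso M N.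
Proof.
case=> f [mf bf]; have [X hX fX] := morphism_hom mf.
exists X => // v; rewrite -row_free_unit; apply: inj_row_free => u uX.
have /bij_inj inj := bf v.
apply: (can_inj (@twK C (s v) _ _)); rewrite tw0; apply: inj.
by rewrite (is_morphism0 _ mf) fX twK uX tw0.
Qed.

Lemma rep_torep (A : rep C G) : exists d (M : mrep d),
  rep_iso A (torep M) /\ forall v, rdim A v = d v.
Proof.
pose d v := dim (rsp A v).
(* The twists at the two ends and that of the arrow cancel by [sP], so the map in coordinates is
   linear and has a matrix. *)
have /fin_all_exists[M MP] : forall a, exists X, forall u : 'rV[C]_(d (asrc a)),
    tw (s (atgt a)) (v2r (rmap A a (@r2v C (rsp A (asrc a)) (tw (s (asrc a)) u)))) = u *m X.
  move=> a; apply: linear_mx => c x y.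
  rewrite twD twZ linearP rmap_add rmap_scale linearP twD twZ /= !twist_twist sP.
  by case: (s (asrc a)); case: (s (atgt a)).
exists d, M; split=> [|v]; last by rewrite /rdim dimvf.
exists (fun v x => v2r x); split.
  split=> [v x y|]; first by rewrite linearD.
  split=> [v c x|a x]; first by rewrite linearZ.
  by rewrite /= /torep_map -MP !twK v2rK.
by move=> v; exists (@r2v C (rsp A v)) => x; [exact: v2rK | exact: r2vK].
Qed.

(** An idempotent [e] other than 0 and 1 splits M into the images of [e] and [1 - e], both
    nonzero. *)
Lemma indecomposable_indec (A : rep C G) d (M : mrep d) :
  indecomposable A -> rep_iso A (torep M) -> indec M.
Proof.
case=> [[v0 Av0] nA] AM; split.
  by exists v0; apply/eqP; rewrite -(rdim_torep M) -(rdim_iso AM).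
move=> e he ee; apply: NNPP => /not_or_and[ne0 ne1]; apply: nA.
have nonzero n (N : mrep n) (X : forall v, 'M[C]_(d v, n v))
    (Y : forall v, 'M[C]_(n v, d v)) :
    ~ (forall v, X v *m Y v = 0) -> nonzero_rep (torep N).
  move=> nXY; apply: NNPP => N0; apply: nXY => v.
  apply/eqP; rewrite -mxrank_eq0 -leqn0.
  apply: leq_trans (mxrankM_maxl _ _) _.
  apply: leq_trans (rank_leq_col _) _; rewrite leqn0.
  by apply/negPn/negP => /eqP nv; apply: N0; exists v; rewrite rdim_torep.
have h1e := is_homB (is_hom1 M) he.
have [d1 [I1 [p1 [j1 [hp1 hj1 fp1 fj1 e1]]]]] := image_fact he.
have [d2 [I2 [p2 [j2 [hp2 hj2 fp2 fj2 e2]]]]] := image_fact h1e.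
have jp11 v : j1 v *m p1 v = 1%:M.
  apply: (row_full_inj (fp1 v)); apply: (row_free_inj (fj1 v)).
  by rewrite /= mulmx1 mulmxA -e1 -mulmxA -e1 ee.
have jp22 v : j2 v *m p2 v = 1%:M.
  apply: (row_full_inj (fp2 v)); apply: (row_free_inj (fj2 v)).
  rewrite /= mulmx1 mulmxA -e2 -mulmxA -e2.
  by rewrite mulmxBr mulmx1 mulmxBl mul1mx ee subrr subr0.
have jp12 v : j1 v *m p2 v = 0.
  apply: (row_full_inj (fp1 v)); apply: (row_free_inj (fj2 v)).
  by rewrite /= mulmx0 mul0mx mulmxA -e1 -mulmxA -e2 mulmxBr mulmx1 ee subrr.
have jp21 v : j2 v *m p1 v = 0.
  apply: (row_full_inj (fp2 v)); apply: (row_free_inj (fj1 v)).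
  by rewrite /= mulmx0 mul0mx mulmxA -e2 -mulmxA -e1 mulmxBl mul1mx ee subrr.
exists (torep I1), (torep I2); split; last split.
- by apply: (nonzero _ _ p1 j1) => e0; apply: ne0 => v; rewrite e1.
- apply: (nonzero _ _ p2 j2) => e0; apply: ne1 => v.
  by apply/esym/eqP; rewrite -subr_eq0 e2 e0.
apply: rep_iso_trans AM _.
have [D1 [Z1 a1]] := hom_morphism hp1; have [D2 [Z2 a2]] := hom_morphism hp2.
exists (fun v (x : 'rV[C]_(d v)) =>
  (tw (s v) (tw (s v) x *m p1 v), tw (s v) (tw (s v) x *m p2 v))).
split.
  split=> [v x y|]; first by rewrite D1 D2.
  split=> [v c x|a x]; first by rewrite Z1 Z2.
  exact: (f_equal2 pair (a1 a x) (a2 a x)).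
move=> v; exists (fun y : 'rV[C]_(d1 v) * 'rV[C]_(d2 v) =>
  tw (s v) (tw (s v) y.1 *m j1 v + tw (s v) y.2 *m j2 v)).
  move=> x /=; rewrite !twK -!mulmxA -e1 -e2 -mulmxDr addrC subrK mulmx1.
  by rewrite twK.
case=> x y /=; rewrite !twK !mulmxDl -!mulmxA jp11 jp12 jp21 jp22.
by rewrite !mulmx0 !mulmx1 addr0 add0r !twK.
Qed.

Lemma nonzero_rep_vec (A : rep C G) : nonzero_rep A ->
  exists v, exists x : rsp A v, x != 0.
Proof.
case=> v Av; exists v, (vpick fullv); rewrite vpick0 -dimv_eq0.
exact/eqP.
Qed.

(** The projection onto the first summand, carried over to M, would be a scalar: nonzero as it fixes
    a nonzero vector of [B1], and zero as it kills one of [B2]. *)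
Lemma brick_indecomposable d (M : mrep d) : (exists v, d v != 0%N) ->
  brick M -> indecomposable (torep M).
Proof.
case=> v0 dv0 bM; split; first by exists v0; rewrite rdim_torep; apply/eqP.
case=> B1 [B2 [/nonzero_rep_vec[v1 [x1 x10]] [/nonzero_rep_vec[v2 [x2 x20]]]]].
case/rep_isoP => F [H [mF mH FK HK]].
have mP : @is_morphism C G (dsum B1 B2) (dsum B1 B2) (fun v x => (x.1, 0)).
  split=> [v x y|]; first by congr (_, _); rewrite addr0.
  split=> [v c x|a x]; first by congr (_, _); rewrite /= scaler0.
  congr (_, _); have := rmap_scale B2 a 0 0.
  by rewrite scaler0 => ->; case: (adashed a); rewrite /= ?conjC0 scale0r.
have [e he eP] := morphism_hom (is_morphism_comp (is_morphism_comp mF mP) mH).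
have [c ec] := bM _ he.
have H0 v x : H v x = 0 -> x = 0.
  by move=> Hx; rewrite -[x]HK Hx (is_morphism0 _ mF).
case: (eqVneq c 0) => [c0|c0].
  have := eP v1 (H v1 (x1, 0)); rewrite HK /= ec c0 raddf0 mulmx0 tw0.
  by move/H0 => [] /eqP; rewrite (negPf x10).
have := eP v2 (H v2 (0, x2)); rewrite HK /= (is_morphism0 _ mH) ec mul_mx_scalar.
rewrite twZ twK => /esym/eqP; rewrite scaler_eq0 => /orP[/eqP tc|/eqP/H0[] /eqP].
  case/eqP: c0; rewrite -[c]/(twist false c) -(addbb (s v2)) -twist_twist tc.
  by case: (s v2); rewrite /= ?conjC0.
by rewrite (negPf x20).
Qed.
End Untwist.

(** * Cycles and dashed arrows *)

Section Bridges.
Variables (C : numClosedFieldType) (G : biquiver).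

Section LineRep.
Variable w : arrow G -> C.
Definition line_map (a : arrow G) (x : C^o) : C^o := w a * twist (adashed a) x.
Arguments line_map : clear implicits.
Lemma line_add a x y : line_map a (x + y) = line_map a x + line_map a y.
Proof. by rewrite /line_map twistD mulrDr. Qed.
Lemma line_scale a c x :
  line_map a (c *: x) = twist (adashed a) c *: line_map a x.
Proof. by rewrite /line_map twistM mulrCA. Qed.
Definition line_rep : rep C G :=
  @Rep C G (fun=> C^o) line_map line_add line_scale.
End LineRep.

(** Taking norms removes the conjugations, so full and dashed arrows satisfy the same relation. *)
Lemma line_rep_iso w w' : rep_iso (line_rep w) (line_rep w') ->
  exists g : 'I_(bq_t G) -> C, (forall v, g v != 0) /\
    forall a, `|w' a| * `|g (asrc a)| = `|g (atgt a)| * `|w a|.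
Proof.
case=> f [mf bf]; have [_ [fZ fa]] := mf.
exists (fun v => f v 1); split=> [v|a].
  apply/eqP => f1; have /bij_inj inj := bf v.
  have /eqP := inj 1 0 (etrans f1 (esym (is_morphism0 v mf))).
  by rewrite oner_eq0.
have := fa a 1.
have -> : rmap (line_rep w) a 1 = w a *: (1 : C^o).
  by rewrite /= /line_map; case: (adashed a); rewrite /= ?conjC1.
rewrite fZ /= /line_map => /(congr1 Num.norm).
by rewrite normrM norm_twist [_ *: _]/(_ * _) normrM [in RHS]mulrC.
Qed.

(** Arrows are told apart by position, so one parallel to [a0] still joins its ends. *)
Definition delete_adj (a0 : arrow G) : rel 'I_(bq_t G) := fun u v =>
  [exists a : arrow G, (a != a0) &&
     (((asrc a == u) && (atgt a == v)) || ((asrc a == v) && (atgt a == u)))].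

Lemma delete_adj_sym a0 : connect_sym (delete_adj a0).
Proof.
by apply: sym_connect_sym => u v; apply: eq_existsb => a; rewrite orbC.
Qed.

(* An isomorphism between the representations with weight 2^n on a0 and 1
   elsewhere has constant modulus along the rest of a cycle through a0. *)
Lemma rep_finite_bridge : rep_finite C G -> forall a0,
  ~~ connect (delete_adj a0) (asrc a0) (atgt a0).
Proof.
move=> fin a0; apply/negP => conn.
pose w (n : nat) (a : arrow G) : C := if a == a0 then 2 ^+ n else 1.
have [I [f fP]] := rep_finite_cover fin (\sum_v rdim (line_rep (w 0%N)) v).
(* Pigeonhole: one more weight than there are classes. *)
have ex (n : 'I_(#|I|.+1)) : exists i, rep_iso (line_rep (w n)) (f i).
  apply: fP => //; exists (asrc a0); rewrite /rdim dimvf.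
  by [].
have /fin_all_exists[h hP] := ex.
suff /leq_card : injective h by rewrite card_ord ltnn.
move=> n m hnm; have isom : rep_iso (line_rep (w n)) (line_rep (w m)).
  by apply: rep_iso_trans (hP n) _; rewrite hnm; apply: rep_iso_sym.
have [g [g0 gP]] := line_rep_iso isom.
have gst : `|g (asrc a0)| = `|g (atgt a0)|.
  have inv : closed (delete_adj a0) [pred v | `|g v| == `|g (asrc a0)|].
    move=> u v /existsP[a /andP[/negPf aa0 e]]; rewrite !inE.
    have := gP a; rewrite /w aa0 normr1 mul1r mulr1 => gg.
    by case/orP: e => /andP[/eqP <- /eqP <-]; rewrite gg.
  by have := closed_connect inv conn; rewrite !inE eqxx => /esym/eqP->.
have := gP a0; rewrite /w eqxx gst mulrC => /mulfI.
rewrite normr_eq0 => /(_ (g0 _))/eqP; rewrite !normrX normr_nat.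
by rewrite -!natrX eqr_nat eqn_exp2l // => /eqP/val_inj.
Qed.

(** Take [s v] to be the parity of the number of dashed bridges [a0] with [v] on their source side.
    The ends of an arrow are separated by that arrow and by no other. *)
Lemma rep_finite_coboundary : rep_finite C G ->
  exists s : 'I_(bq_t G) -> bool,
    forall a : arrow G, adashed a = s (asrc a) (+) s (atgt a).
Proof.
move=> /rep_finite_bridge bridge.
exists (fun v => \big[addb/false]_(a0 | adashed a0)
                   connect (delete_adj a0) (asrc a0) v) => a.
rewrite -big_split /=.
have E a0 : connect (delete_adj a0) (asrc a0) (asrc a) (+)
            connect (delete_adj a0) (asrc a0) (atgt a) = (a0 == a).
  case: (eqVneq a0 a) => [->|ne]; first by rewrite connect0 (negPf (bridge a)).
  suff /(same_connect_r (delete_adj_sym a0)) -> :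
    connect (delete_adj a0) (asrc a) (atgt a) by rewrite addbb.
  by apply/connect1/existsP; exists a; rewrite eq_sym ne !eqxx.
under eq_bigr do rewrite E.
case ad: (adashed a); last first.
  by rewrite big1 // => a0; case: eqP => // ->; rewrite ad.
rewrite (bigD1 a) //= eqxx big1 // => a0 /andP[_ /negPf] -> //.
Qed.
End Bridges.

(** * Rigidity and positivity from representation-finiteness, and the classification by the Tits
    form *)

Lemma titsE G z : tits G z = euler (@asrc G) (@atgt G) z z.
Proof.
by rewrite /tits /euler [X in _ - X = _]big_tnth.
Qed.

Lemma eq_euler t k (src tgt : 'I_k -> 'I_t) m m' n n' :
  m =1 m' -> n =1 n' -> euler src tgt m n = euler src tgt m' n'.
Proof.
by move=> mm nn; congr (_ - _); apply: eq_bigr => i _; rewrite mm nn.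
Qed.

Lemma rep_finite_rigid (C : numClosedFieldType) (G : biquiver)
    (z : 'I_(bq_t G) -> nat) :
  rep_finite C G -> (exists v, z v != 0%N) ->
  exists M : @mrep C _ _ (@asrc G) (@atgt G) z, ext0 M M.
Proof.
move=> fin [v0 z0]; have [s sP] := rep_finite_coboundary fin.
apply: rigid_exists.
have [I [f fP]] := rep_finite_cover fin (\sum_v z v).
(* Matrix representations are classed by the representation [f i] to which their [torep] is
   isomorphic. *)
exists I, (fun i M => rep_iso (torep sP M) (f i)); split=> [M|i M N iM iN].
  apply: fP; first by exists v0; rewrite rdim_torep; apply/eqP.
  by rewrite (eq_bigr _ (fun v _ => rdim_torep sP M v)).
exact: iso_miso (rep_iso_trans iM (rep_iso_sym iN)).
Qed.

Lemma rep_finite_pos (C : numClosedFieldType) (G : biquiver)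
    (z : 'I_(bq_t G) -> nat) :
  rep_finite C G -> (exists v, z v != 0%N) ->
  1 <= euler (@asrc G) (@atgt G) z z.
Proof.
move=> fin z0; have [M /ext0_hdim <-] := rep_finite_rigid fin z0.
rewrite lez_nat; apply/hdim_gt0; exists (fun v => 1%:M); first exact: is_hom1.
case: z0 => v zv; exists v; apply: contraNneq zv => m1.
by rewrite -(@mxrank1 C (z v)) m1 mxrank0.
Qed.

Theorem theorem1 (C : numClosedFieldType) (G : biquiver)
    (z : 'I_(bq_t G) -> nat) :
  bq_connected G -> rep_finite C G ->
  ((exists A : rep C G, indecomposable A /\ forall v, rdim A v = z v)
     <-> tits G z = 1)
  /\ (forall A B : rep C G,
        indecomposable A -> indecomposable B ->
        (forall v, rdim A v = z v) -> (forall v, rdim B v = z v) ->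
        rep_iso A B).
Proof.
move=> _ fin; have [s sP] := rep_finite_coboundary fin.
have pos z' := @rep_finite_pos C G z' fin.
(* The matrix dimension [d] equals [z] only pointwise, so values of the form are carried over by
   [eq_euler]. *)
have brickA A : indecomposable A -> (forall v, rdim A v = z v) ->
    exists d (M : @mrep C _ _ (@asrc G) (@atgt G) d),
    [/\ rep_iso A (torep sP M), d =1 z, brick M, ext0 M M
      & tits G z = 1].
  move=> indA dA; have [d [M [AM dM]]] := rep_torep sP A.
  have iM := indecomposable_indec indA AM.
  have bM := indec_brick pos iM.
  have [e1 eM] := brick_euler pos (proj1 iM) bM.
  have dz : d =1 z by move=> v; rewrite -dM dA.
  by exists d, M; split=> //; rewrite titsE -(eq_euler _ _ dz dz).
split; first split.
- by case=> A [indA /(brickA A indA)[d [M [_ _ _ _]]]].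
- rewrite titsE => e1.
  have z0 : exists v, z v != 0%N.
    apply: NNPP => nz; have zz : z =1 fun=> 0%N.
      by move=> v; apply/eqP/negPn/negP => zv; apply: nz; exists v.
    by move: e1; rewrite (eq_euler _ _ zz zz) /euler !big1.
  have [M eM] := rep_finite_rigid fin z0.
  exists (torep sP M); split; last exact: rdim_torep.
  apply: brick_indecomposable => //; apply/brick_hdim => //.
  (* For rigid M, dim End(M) = q(z) = 1. *)
  by move/ext0_hdim: eM; rewrite e1 => -[].
move=> A B indA indB dA dB.
have [m [M [AM mz bM _ t1]]] := brickA A indA dA.
have [n [N [BN nz _ eN _]]] := brickA B indB dB.
have mn : m =1 n by move=> v; rewrite mz nz.
have [|X hX fX] := brick_rigid_iso mn _ bM eN.
  by rewrite (eq_euler _ _ mz nz) -titsE t1.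
apply: rep_iso_trans AM _; apply: rep_iso_trans (rep_iso_sym BN).
apply: (torep_iso sP hX fX) => v.
(* An injective map between spaces of equal dimension is surjective. *)
by rewrite -col_leq_rank -[X in (X <= _)%N]mn (eqP (fX v)).
Qed.
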